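(* Let $g\ge3$, and let $\overline{M_m}$, $0\le m\le\lceil g/2\rceil$, be the matrices defined in the context, regarded as spin structures of $\Sigma_g$. For $1\le m\le\lceil g/2\rceil$, the isotropy group at $\overline{M_m}$ for the $\mathfrak{S}_{2g+2}$ action is exactly $$\mathfrak{G}_m:=\langle \sigma_i \mid 1\le i\le 2g+1,\ i\ne g+1+2m\rangle\cong \mathfrak{S}_{g+1+2m}\times\mathfrak{S}_{g+1-2m}$$ (with $\mathfrak{S}_0$ trivial), and the isotropy group at $\overline{M_0}$ is exactly $$\mathfrak{G}_0:=\langle \sigma_i,\tau \mid 1\le i\le 2g+1,\ i\ne g+1\rangle,$$ where $\tau=(1,2g+2)(2,2g+1)(3,2g)\cdots(g+1,g+2)$ is the product of the transpositions $(i,2g+3-i)$, $1\le i\le g+1$.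
   Context: $\Sigma_g$ is a compact connected oriented surface of genus $g$, and $\alpha_1,\dots,\alpha_g,\beta_1,\dots,\beta_g$ is a symplectic basis of $H_1(\Sigma_g,\mathbb{Z}/2)$, i.e. $\alpha_i\cdot\beta_j=\delta_{ij}$, $\alpha_i\cdot\alpha_j=\beta_i\cdot\beta_j=0$ for the mod 2 intersection number. A spin structure is a map $c:H_1(\Sigma_g,\mathbb{Z}/2)\to\mathbb{Z}/2$ with $c(x+y)=c(x)+c(y)+x\cdot y$ for all $x,y$; $\mathcal{C}$ is the set of spin structures. The corresponding matrix of $c$ is the $2\times g$ matrix $M$ over $\mathbb{Z}/2$ whose $i$-th column is $\begin{pmatrix}c(\alpha_i)\\c(\beta_i)\end{pmatrix}$; it determines $c$, every $2\times g$ matrix over $\mathbb{Z}/2$ arises, and spin structures are identified with their matrices. For $\gamma\in H_1(\Sigma_g,\mathbb{Z}/2)$ let $T_\gamma(x)=x+(x\cdot\gamma)\gamma$, an element of the group $Sp_{2g}(\mathbb{Z}/2)$ of automorphisms preserving the intersection number. Let $\sigma_i=(i,i+1)\in\mathfrak{S}_{2g+2}$, $1\le i\le 2g+1$, where $\mathfrak{S}_n$ is the symmetric group. The group $\mathfrak{S}_{2g+2}$ acts through the homomorphism $\iota:\mathfrak{S}_{2g+2}\to Sp_{2g}(\mathbb{Z}/2)$ determined by $\iota(\sigma_1)=T_{\beta_1}$, $\iota(\sigma_{2g+1})=T_{\beta_g}$, $\iota(\sigma_{2i})=T_{\alpha_i}$ ($1\le i\le g$), $\iota(\sigma_{2j+1})=T_{\beta_j+\beta_{j+1}}$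 ($1\le j\le g-1$). It acts on $\mathcal{C}$ from the right by $c\circ\sigma:=c\circ\iota(\sigma)$. The isotropy group at $c$ is $\{\sigma\in\mathfrak{S}_{2g+2}: c\circ\sigma=c\}$. For $i\ge1$, $A_i$ is the $2\times(2i-1)$ matrix over $\mathbb{Z}/2$ whose odd-numbered columns are $\begin{pmatrix}1\\1\end{pmatrix}$ and whose even-numbered columns are $\begin{pmatrix}1\\0\end{pmatrix}$. The $2\times g$ matrices $\overline{M_m}$ are defined by horizontal concatenation of blocks, where $k\ge1$: Case $g=4k-1$ ($0\le m\le 2k$): $\overline{M_{2i}}=\begin{pmatrix}A_{k+i}&\begin{matrix}0\\0\end{matrix}&A_{k-i}\end{pmatrix}$ for $0\le i\le k-1$; $\overline{M_{2i+1}}=\begin{pmatrix}A_{k+i}&\begin{matrix}1&0&1\\0&1&0\end{matrix}&A_{k-i-1}\end{pmatrix}$ for $0\le i\le k-2$; $\overline{M_{2k-1}}=\begin{pmatrix}A_{2k-1}&\begin{matrix}1&0\\0&1\end{matrix}\end{pmatrix}$; $\overline{M_{2k}}=A_{2k}$. Case $g=4k+1$ ($0\le m\le 2k+1$): $\overline{M_{2i}}=\begin{pmatrix}A_{k+i}&\begin{matrix}1&0&1\\0&1&0\end{matrix}&A_{k-i}\end{pmatrix}$ for $0\le i\le k-1$; $\overline{M_{2i+1}}=\begin{pmatrix}A_{k+i+1}&\begin{matrix}0\\0\end{matrix}&A_{k-i}\end{pmatrix}$ for $0\le i\le k-1$; $\overline{M_{2k}}=\begin{pmatrix}A_{2k}&\begin{matrix}1&0\\0&1\end{matrix}\end{pmatrix}$;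 $\overline{M_{2k+1}}=A_{2k+1}$. Case $g=4k$ ($0\le m\le 2k$): $\overline{M_{2i}}=\begin{pmatrix}A_{k+i}&\begin{matrix}1&1\\0&0\end{matrix}&A_{k-i}\end{pmatrix}$ for $0\le i\le k-1$; $\overline{M_{2i+1}}=\begin{pmatrix}A_{k+i+1}&A_{k-i}\end{pmatrix}$ for $0\le i\le k-1$; $\overline{M_{2k}}=\begin{pmatrix}A_{2k}&\begin{matrix}1\\0\end{matrix}\end{pmatrix}$. Case $g=4k+2$ ($0\le m\le 2k+1$): $\overline{M_{2i}}=\begin{pmatrix}A_{k+i+1}&A_{k-i+1}\end{pmatrix}$ for $0\le i\le k$; $\overline{M_{2i+1}}=\begin{pmatrix}A_{k+i+1}&\begin{matrix}1&1\\0&0\end{matrix}&A_{k-i}\end{pmatrix}$ for $0\le i\le k-1$; $\overline{M_{2k+1}}=\begin{pmatrix}A_{2k+1}&\begin{matrix}1\\0\end{matrix}\end{pmatrix}$. *)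

(* Defs.v *)
From mathcomp Require Import all_boot all_order all_fingroup all_algebra.
From mathcomp Require Import zify.
Set Implicit Arguments.
Unset Strict Implicit.
Unset Printing Implicit Defensive.
Import GRing.Theory.

(* The points permuted are 1, ..., 2g+2; 'I_(2 * g).+2 is 0-based. *)
Definition pt (g j : nat) : 'I_(2 * g).+2 := inord j.-1.

Definition sigma (g i : nat) : 'S_(2 * g).+2 := tperm (pt g i) (pt g i.+1).

Definition tau (g : nat) : 'S_(2 * g).+2 :=
  (\prod_(1 <= i < g.+2) tperm (pt g i) (pt g (2 * g + 3 - i)))%g.

Definition sigmas_but (g n : nat) : {set 'S_(2 * g).+2} :=
  [set sigma g i | i : 'I_(2 * g).+2 & (1 <= i) && (i != n :> nat)].

Definition Gpos (g m : nat) : {set 'S_(2 * g).+2} :=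
  <<sigmas_but g (g + 1 + 2 * m)>>%g.

Definition Gzero (g : nat) : {set 'S_(2 * g).+2} :=
  <<tau g |: sigmas_but g (g + 1)>>%g.

Local Open Scope ring_scope.

(* H stands for H_1(Sigma_g, Z/2) and dot for the mod 2 intersection number:
   up to isometry a symplectic basis (alpha, beta) determines this pair. *)
Section Homology.
Variables (g : nat) (H : finLmodType 'F_2) (dot : {symmetric H}).

Definition is_basis (alpha beta : 'I_g -> H) : Prop :=
  forall x : H, exists! u : 'rV['F_2]_g * 'rV['F_2]_g,
    x = \sum_i u.1 0 i *: alpha i + \sum_i u.2 0 i *: beta i.

Record symplectic_basis (alpha beta : 'I_g -> H) : Prop := SymplecticBasis {
  sympl_basis : is_basis alpha beta;
  sympl_ab : forall i j, dot (alpha i) (beta j) = (i == j)%:R;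
  sympl_aa : forall i j, dot (alpha i) (alpha j) = 0;
  sympl_bb : forall i j, dot (beta i) (beta j) = 0 }.

Definition Sp : {set {perm H}} :=
  [set f : {perm H} |
    [forall k : 'F_2, forall x, forall y, f (k *: x + y) == k *: f x + f y]
    && [forall x, forall y, dot (f x) (f y) == dot x y]].

Definition transvection (gamma x : H) : H := x + dot x gamma *: gamma.

(* The product of permutations is s * t = t \o s in MathComp, both on
   'S_(2 * g).+2 and on {perm H}, so being a homomorphism between these groups
   does not depend on the composition convention.  Basis vectors are indexed
   from 0: alpha_i of the text is [alpha] at i - 1. *)
Record is_iota (alpha beta : 'I_g -> H)
    (iota : {morphism [set: 'S_(2 * g).+2] >-> {perm H}}) : Prop := IsIota {
  iota_Sp : forall s, iota s \in Sp;
  iota_first : forall i : 'I_g, i = 0%N :> nat ->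
    iota (sigma g 1) =1 transvection (beta i);
  iota_last : forall i : 'I_g, i.+1 = g :> nat ->
    iota (sigma g (2 * g).+1) =1 transvection (beta i);
  iota_even : forall i : 'I_g,
    iota (sigma g (2 * i.+1)) =1 transvection (alpha i);
  iota_odd : forall i j : 'I_g, j = i.+1 :> nat ->
    iota (sigma g (2 * i.+1).+1) =1 transvection (beta i + beta j) }.

Definition spin_structures : {set {ffun H -> 'F_2}} :=
  [set c : {ffun H -> 'F_2} |
    [forall x, forall y, c (x + y) == c x + c y + dot x y]].

Definition spin_matrix (alpha beta : 'I_g -> H) (c : {ffun H -> 'F_2}) :
    'M['F_2]_(2, g) :=
  \matrix_(i < 2, j < g) (if i == 0 then c (alpha j) else c (beta j)).

Definition spin_act (iota : {morphism [set: 'S_(2 * g).+2] >-> {perm H}})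
    (c : {ffun H -> 'F_2}) (s : 'S_(2 * g).+2) : {ffun H -> 'F_2} :=
  [ffun x => c (iota s x)].

Definition isotropy (iota : {morphism [set: 'S_(2 * g).+2] >-> {perm H}})
    (c : {ffun H -> 'F_2}) : {set 'S_(2 * g).+2} :=
  [set s | spin_act iota c s == c].

End Homology.

(* Matrices with two rows are first written as the list of their columns
   (top entry, bottom entry), so that horizontal concatenation is [++]. *)
Definition col11 : 'F_2 * 'F_2 := (1, 1).
Definition col10 : 'F_2 * 'F_2 := (1, 0).
Definition col01 : 'F_2 * 'F_2 := (0, 1).
Definition col00 : 'F_2 * 'F_2 := (0, 0).

(* 0-based even positions are the odd-numbered columns. *)
Definition Acols (i : nat) : seq ('F_2 * 'F_2) :=
  mkseq (fun j => if odd j then col10 else col11) (2 * i - 1).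

Definition Mbar_4km1 (k m : nat) : seq ('F_2 * 'F_2) :=
  let i := m./2 in
  if m == (2 * k)%N then Acols (2 * k)
  else if m == (2 * k - 1)%N then Acols (2 * k - 1) ++ [:: col10; col01]
  else if odd m then
    Acols (k + i) ++ [:: col10; col01; col10] ++ Acols (k - i - 1)
  else Acols (k + i) ++ [:: col00] ++ Acols (k - i).

Definition Mbar_4kp1 (k m : nat) : seq ('F_2 * 'F_2) :=
  let i := m./2 in
  if m == (2 * k + 1)%N then Acols (2 * k + 1)
  else if m == (2 * k)%N then Acols (2 * k) ++ [:: col10; col01]
  else if odd m then Acols (k + i + 1) ++ [:: col00] ++ Acols (k - i)
  else Acols (k + i) ++ [:: col10; col01; col10] ++ Acols (k - i).

Definition Mbar_4k (k m : nat) : seq ('F_2 * 'F_2) :=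
  let i := m./2 in
  if m == (2 * k)%N then Acols (2 * k) ++ [:: col10]
  else if odd m then Acols (k + i + 1) ++ Acols (k - i)
  else Acols (k + i) ++ [:: col10; col10] ++ Acols (k - i).

Definition Mbar_4kp2 (k m : nat) : seq ('F_2 * 'F_2) :=
  let i := m./2 in
  if m == (2 * k + 1)%N then Acols (2 * k + 1) ++ [:: col10]
  else if odd m then
    Acols (k + i + 1) ++ [:: col10; col10] ++ Acols (k - i)
  else Acols (k + i + 1) ++ Acols (k - i + 1).

Definition Mbar_cols (g m : nat) : seq ('F_2 * 'F_2) :=
  match (g %% 4)%N with
  | 0 => Mbar_4k (g %/ 4) m
  | 1 => Mbar_4kp1 (g %/ 4) m
  | 2 => Mbar_4kp2 (g %/ 4) m
  | _ => Mbar_4km1 (g.+1 %/ 4) m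
  end.

(* uphalf g is the ceiling of g/2; by this lemma the default value of [nth] in
   [Mbar] is never reached. *)
Lemma size_Mbar_cols g m :
  (3 <= g)%N -> (m <= uphalf g)%N -> size (Mbar_cols g m) = g.
Proof.
have szA i : size (Acols i) = (2 * i - 1)%N by rewrite size_mkseq.
rewrite /Mbar_cols => g3 mg; have g4 := divn_eq g 4.
have m2 := odd_double_half m.
have : (g %% 4 < 4)%N by rewrite ltn_mod.
case: (g %% 4)%N g4 => [|[|[|[|//]]]] g4 _;
  rewrite /Mbar_4k /Mbar_4kp1 /Mbar_4kp2 /Mbar_4km1;
  do ?[case: eqP => ?]; do ?[case: ifP => ?];
  rewrite ?size_cat /= !szA; lia.
Qed.

Definition Mbar (g m : nat) : 'M['F_2]_(2, g) :=
  \matrix_(i < 2, j < g)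
    (let col := nth col00 (Mbar_cols g m) j in if i == 0 then col.1 else col.2).

(* Main.v *)
(** Let S be the set of the N = 2g+2 branch points.  Put e_0 = 0 and let e_q be
    the sum of the classes gamma_1, ..., gamma_q with iota(sigma_i) =
    T_(gamma_i); the class e_a + e_b is then the lift of an arc joining a to b,
    the transposition (a b) acts by its transvection, and iota(s) sends e_a + e_b
    to e_(s a) + e_(s b).  These classes span homology, so a spin structure c is
    determined by its values on them.  The matrix Mbar_m says that
    c(gamma_i) = 1 except for i = n := g+1+2m, hence for a <> b,
    c(e_a + e_b) = 1 if and only if a and b lie on the same side of the cut
    {1..n} | {n+1..N}.  The isotropy group is therefore the stabilizer of this
    partition into two blocks; the blocks can be exchanged only if m = 0, and
    tau does so. *)
Require Import Defs.
From mathcomp Require Import all_boot all_order all_fingroup all_algebra.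
From mathcomp Require Import zify.
Set Implicit Arguments.
Unset Strict Implicit.
Unset Printing Implicit Defensive.
Import GRing.Theory.
Local Open Scope ring_scope.

(** * Arithmetic in characteristic two *)

Lemma F2_addrr (k : 'F_2) : k + k = 0.
Proof. by apply: addrr_pchar2; apply: pchar_Fp. Qed.

Lemma natr_addb (a b : bool) : (a (+) b)%:R = a%:R + b%:R :> 'F_2.
Proof. by case: a; case: b; apply/val_inj. Qed.

Lemma natr_bool_inj (a b : bool) : a%:R = b%:R :> 'F_2 -> a = b.
Proof. by case: a; case: b. Qed.

Lemma addrr_F2 (V : lmodType 'F_2) (x : V) : x + x = 0.
Proof. by rewrite -[x]scale1r -scalerDl F2_addrr scale0r. Qed.

Lemma F2P (k : 'F_2) : {k = 0} + {k = 1}.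
Proof. by case: k => [[|[|//]] lt_k]; [left | right]; apply/val_inj. Qed.

(** * Permutations preserving a subset, and the transpositions generating them *)

(** Induction on the number of moved points: multiplying [s] by the transposition of [a] and [s a]
    fixes [a] and moves no new point. *)
Lemma mem_group_of_tperm (T : finType) (f : T -> bool) (G : {group {perm T}}) :
  (forall a b, f a = f b -> tperm a b \in G) ->
  forall s : {perm T}, (forall x, f (s x) = f x) -> s \in G.
Proof.
move=> tG s; have [n] := ubnP #|[set x | s x != x]|; elim: n s => // n IHn s.
rewrite ltnS => le_n sf.
have [a sa | fix_s] := pickP (fun x => s x != x); last first.
  suff -> : s = 1%g by apply: group1.
  by apply/permP => x; rewrite perm1; apply/eqP; rewrite -[_ == _]negbK fix_s.
rewrite -(groupMr _ (tG a (s a) (esym (sf a)))); apply: IHn; last first.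
  by move=> x; rewrite permM; case: tpermP => [<-|/perm_inj ->|]; rewrite ?sf.
apply: leq_trans le_n; apply: proper_card; apply/properP; split; last first.
  by exists a; rewrite !inE // permM tpermR eqxx.
apply/subsetP => x; rewrite !inE permM; apply: contra => /eqP sx.
rewrite sx tpermD //; apply: contraNneq sa => Ex; first by rewrite Ex sx.
by apply/eqP; apply: (@perm_inj _ s); rewrite Ex.
Qed.

(** Conjugating (a b) by (b b+1) gives (a b+1), so only adjacent transpositions between [a] and [b]
    are used. *)
Lemma tperm_of_adjacent (N : nat) (G : {group 'S_N.+1}) (a b : nat) :
  (a < b <= N)%N ->
  (forall i, (a <= i < b)%N -> tperm (inord i) (inord i.+1) \in G) ->
  tperm (inord a) (inord b : 'I_N.+1) \in G.
Proof.
move=> /andP[]; elim: b => // b IHb; rewrite ltnS leq_eqVlt.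
case/predU1P=> [->|lt_ab] lt_bN tG; first by apply: tG; rewrite leqnn ltnSn.
have tab : tperm (inord a) (inord b) \in G.
  by apply: IHb => // [|i /andP[le_ai lt_ib]]; [lia | apply: tG; lia].
have tb : tperm (inord b) (inord b.+1) \in G by apply: tG; lia.
suff -> : tperm (inord a) (inord b.+1 : 'I_N.+1) =
  (tperm (inord a) (inord b) ^ tperm (inord b) (inord b.+1))%g.
  by rewrite groupJ.
rewrite tpermJ tpermL tpermD // -val_eqE /= !inordK; lia.
Qed.

Lemma astabs_permP (T : finType) (p : pred T) (s : {perm T}) :
  reflect (forall x, p (s x) = p x) (s \in 'N([set x | p x] | 'P))%g.
Proof.
apply: (iffP idP) => [sN x | sP].
  by have := astabs_act x sN; rewrite !inE.
by rewrite !inE; apply/subsetP => x; rewrite !inE sP.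
Qed.

Lemma mem_gen_sigmas_but (g n i : nat) : (i < (2 * g).+1)%N -> i.+1 != n ->
  tperm (inord i) (inord i.+1) \in <<sigmas_but g n>>%g.
Proof.
move=> lt_i ne_n; apply/mem_gen/imsetP.
have lt_i' : (i.+1 < (2 * g).+2)%N by lia.
by exists (Ordinal lt_i') => //; rewrite inE /= ne_n.
Qed.

(** In 0-based numbering [sigma g i] exchanges i-1 and i, so only the omitted index [n] would cross
    the cut. Conversely, a transposition inside a block is built from adjacent ones of that
    block. *)
Lemma gen_sigmas_but (g n : nat) :
  <<sigmas_but g n>>%g = 'N([set x : 'I_(2 * g).+2 | (x < n)%N] | 'P)%g.
Proof.
apply/eqP; rewrite eqEsubset gen_subG; apply/andP; split.
  apply/subsetP => _ /imsetP[i + ->]; rewrite inE => /andP[i_gt0 ne_in].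
  apply/astabs_permP => x; rewrite /sigma /pt.
  have lt_i := ltn_ord i.
  case: tpermP => // ->; rewrite !inordK; lia.
apply/subsetP => s /astabs_permP.
apply: (@mem_group_of_tperm _ (fun x : 'I__ => (x < n)%N)) => a b.
wlog lt_ab : a b / (a < b)%N => [IH|fab].
  case: (ltngtP a b) => [|lt_ba /esym fba|/val_inj->]; first exact: IH.
    by rewrite tpermC; apply: IH.
  by rewrite tperm1.
rewrite -[a]inord_val -[b]inord_val; apply: tperm_of_adjacent => [|i le_i].
  by rewrite lt_ab -ltnS ltn_ord.
have := ltn_ord b.
by move=> lt_b; apply: mem_gen_sigmas_but; lia.
Qed.

Lemma sigmas_generate (g : nat) (G : {group 'S_(2 * g).+2}) :
  (forall i, (1 <= i <= (2 * g).+1)%N -> sigma g i \in G) ->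
  forall s, s \in G.
Proof.
move=> sG s; have : s \in <<sigmas_but g 0>>%g.
  by rewrite gen_sigmas_but; apply/astabs_permP.
apply/subsetP; rewrite gen_subG; apply/subsetP => _ /imsetP[i iP ->].
move: iP; rewrite inE => /andP[i_gt0 _].
by apply: sG; rewrite i_gt0 -ltnS ltn_ord.
Qed.

Lemma tau_rev (g : nat) (x : 'I_(2 * g).+2) : tau g x = rev_ord x.
Proof.
(* The first [k] transpositions reverse the [k] outermost points at each end and fix the rest. *)
suff tauk k : (k <= g.+1)%N ->
    (\prod_(1 <= i < k.+1) tperm (pt g i) (pt g (2 * g + 3 - i)))%g x =
    if ((x < k) || ((2 * g).+1 - x < k))%N then rev_ord x else x.
  by rewrite tauk //; case: ifP => //; have := ltn_ord x; lia.
elim: k => [|k IHk] le_k; first by rewrite big_geq // perm1.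
rewrite big_nat_recr //= permM IHk /pt /=; last by lia.
have lt_x := ltn_ord x.
apply: val_inj; case: ifP => Hk.
  rewrite tpermD; last 2 first.
  - by rewrite -val_eqE /= !inordK; lia.
  - by rewrite -val_eqE /= !inordK; lia.
  by case: ifP => //; lia.
case: tpermP => [Ex|Ex|/eqP + /eqP +].
- by case: ifP => /=; rewrite ?Ex ?inordK; lia.
- by case: ifP => /=; rewrite ?Ex ?inordK; lia.
by case: ifP => //=; rewrite -!val_eqE /= ?inordK; lia.
Qed.

(** * The block embedding of a product of two symmetric groups *)

Definition sum_perm_fun n1 n2 (p : 'S_n1 * 'S_n2) (x : 'I_(n1 + n2)) :=
  unsplit (match split x with inl i => inl (p.1 i) | inr j => inr (p.2 j) end).

Lemma sum_perm_fun_inj n1 n2 (p : 'S_n1 * 'S_n2) : injective (sum_perm_fun p).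
Proof.
apply: (can_inj (g := sum_perm_fun (p^-1)%g)) => x.
by rewrite -[x]splitK /sum_perm_fun !unsplitK; case: (split x) => i;
  rewrite /= permK.
Qed.

Definition sum_perm n1 n2 (p : 'S_n1 * 'S_n2) : 'S_(n1 + n2) :=
  perm (@sum_perm_fun_inj n1 n2 p).

Lemma sum_permE n1 n2 (p : 'S_n1 * 'S_n2) u :
  sum_perm p (unsplit u) =
  unsplit (match u with inl i => inl (p.1 i) | inr j => inr (p.2 j) end).
Proof. by rewrite permE /sum_perm_fun unsplitK. Qed.

Lemma sum_permM n1 n2 :
  {in setX [set: 'S_n1] [set: 'S_n2] &, {morph @sum_perm n1 n2 : p q / p * q}%g}.
Proof.
move=> p q _ _; apply/permP => x; rewrite -[x]splitK permM !sum_permE.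
by case: (split x) => i /=; rewrite permM.
Qed.

(** The block embedding is injective. Its image is the whole stabilizer because it contains every
    transposition inside a block. *)
Lemma astabs_isog (N n1 n2 : nat) : (n1 + n2)%N = N ->
  'N([set x : 'I_N | (x < n1)%N] | 'P)%g \isog setX [set: 'S_n1] [set: 'S_n2].
Proof.
move=> <-; pose phi := Morphism (@sum_permM n1 n2).
have phi_inj : ('injm phi)%g.
  apply/injmP => p q _ _ eq_pq.
  have eq_u u := congr1 (fun s : 'S_ _ => split (s (unsplit u))) eq_pq.
  case: p q eq_u {eq_pq} => [p1 p2] [q1 q2] /= eq_u.
  congr pair; apply/permP => i.
    by have := eq_u (inl i); rewrite !sum_permE !unsplitK => -[].
  by have := eq_u (inr i); rewrite !sum_permE !unsplitK => -[].
suff <- : (phi @* setX setT setT = 'N([set x : 'I_ _ | (x < n1)%N] | 'P))%g.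
  by rewrite isog_sym (sub_isog (subxx _) phi_inj).
have dom p : p \in setX [set: 'S_n1] [set: 'S_n2] by rewrite !inE.
apply/eqP; rewrite eqEsubset; apply/andP; split; apply/subsetP => s.
  case/morphimP => p _ _ -> {s}; apply/astabs_permP => x.
  rewrite -[x]splitK sum_permE; case: (split x) => i /=; rewrite ?ltn_ord //.
  by lia.
move=> /astabs_permP; apply: (@mem_group_of_tperm _ (fun x : 'I__ => (x < n1)%N)).
move=> a b; rewrite -[a]splitK -[b]splitK.
case: (split a) (split b) => i [] j /=; rewrite ?ltn_ord; try lia; move=> _.
- apply/morphimP; exists (tperm i j, 1%g) => //=.
  apply/permP => x; rewrite -[x]splitK.
  rewrite sum_permE; case: (split x) => k /=.
    by rewrite (inj_tperm _ _ _ (@lshift_inj _ _)).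
  by rewrite perm1 tpermD // eq_lrshift.
- apply/morphimP; exists (1%g, tperm i j) => //=.
  apply/permP => x; rewrite -[x]splitK.
  rewrite sum_permE; case: (split x) => k /=.
    by rewrite perm1 tpermD // eq_rlshift.
  by rewrite (inj_tperm _ _ _ (@rshift_inj _ _)).
Qed.

(** * The columns of the matrices and the cut that they encode *)

(* In the notation of the header the two entries are c(gamma_(2j+2)) and
   c(gamma_1) + c(gamma_3) + ... + c(gamma_(2j+1)). *)
Definition cut_col (n j : nat) : 'F_2 * 'F_2 :=
  ((j.*2.+2 != n)%:R, (~~ odd j (+) (odd n && (n < j.*2.+2)%N))%:R).

Lemma cut_colE n j b c : (j.*2.+2 != n) = b ->
  ~~ odd j (+) (odd n && (n < j.*2.+2)%N) = c -> (b%:R, c%:R) = cut_col n j.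
Proof. by rewrite /cut_col => -> ->. Qed.

Lemma cut_col_lt n j : (j.*2.+2 < n)%N -> cut_col n j = (1, (~~ odd j)%:R).
Proof.
by move=> lt_jn; rewrite /cut_col ltn_eqF // ltnNge ltnW //= andbF addbF.
Qed.

Lemma cut_col_gt n j : (n < j.*2.+2)%N ->
  cut_col n j = (1, (~~ odd j (+) odd n)%:R).
Proof. by move=> lt_nj; rewrite /cut_col gtn_eqF // lt_nj andbT. Qed.

Lemma nth_Acols i l : (l < 2 * i - 1)%N ->
  nth col00 (Acols i) l = (1, (~~ odd l)%:R).
Proof. by move=> lt_l; rewrite nth_mkseq //; case: odd. Qed.

(** The first block lies before the cut and the last one after it, where the alternation of bottom
    entries is shifted by the parity of [n]. Since [k] has this parity, the last block restarts in
    the right phase; only [mid] has to be checked. *)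
Lemma nth_Acols_cat p mid q n j :
  let k := (2 * p - 1 + size mid)%N in
  (0 < p)%N -> (4 * p - 1 <= n < k.*2.+2)%N -> odd k = odd n ->
  (forall l, (l < size mid)%N -> nth col00 mid l = cut_col n (2 * p - 1 + l)) ->
  (j < k + (2 * q - 1))%N ->
  nth col00 (Acols p ++ mid ++ Acols q) j = cut_col n j.
Proof.
move=> k p_gt0 /andP[le_pn lt_nk] odd_k midE lt_j.
rewrite !nth_cat size_mkseq; case: ltnP => [lt_jp | le_pj].
  by rewrite nth_Acols // cut_col_lt //; lia.
case: ltnP => [lt_jm | le_mj]; first by rewrite midE // subnKC.
have le_kj : (k <= j)%N by rewrite /k; lia.
rewrite -subnDA -/k nth_Acols; last by lia.
by rewrite oddB // cut_col_gt ?odd_k; [rewrite addNb | lia].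
Qed.

(** The residue of n = g+1+2m mod 4 decides which of four middle parts occurs, whatever the residue
    of [g]. *)
Lemma nth_Mbar_cols g m j : (3 <= g)%N -> (m <= uphalf g)%N -> (j < g)%N ->
  nth col00 (Mbar_cols g m) j = cut_col (g + 1 + 2 * m) j.
Proof.
(* For the largest values of [m] the matrix is a truncated pattern; appending the missing columns
   restores the common shape with an empty last block. *)
have cat_nil s t : (j < size s)%N -> nth col00 s j = nth col00 (s ++ t) j.
  by move=> lt_j; rewrite nth_cat lt_j.
have szA i : size (Acols i) = (2 * i - 1)%N by rewrite size_mkseq.
have cut01 p q n : (0 < p)%N -> n = (4 * p + 2)%N ->
    (j < 2 * p + 2 + (2 * q - 1))%N ->
    nth col00 (Acols p ++ [:: col10; col01; col10] ++ Acols q) j = cut_col n j.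
  move=> p_gt0 -> lt_j; apply: nth_Acols_cat => //=; try lia.
  move=> [|[|[|//]]] _; [ apply: (@cut_colE _ _ true false)
    | apply: (@cut_colE _ _ false true) | apply: (@cut_colE _ _ true false)]; lia.
have cut00 p q n : (0 < p)%N -> n = (4 * p)%N ->
    (j < 2 * p + (2 * q - 1))%N ->
    nth col00 (Acols p ++ [:: col00] ++ Acols q) j = cut_col n j.
  move=> p_gt0 -> lt_j; apply: nth_Acols_cat => //=; try lia.
  by move=> [|//] _; apply: (@cut_colE _ _ false false); lia.
have cut10 p q n : (0 < p)%N -> n = (4 * p + 1)%N ->
    (j < 2 * p + 1 + (2 * q - 1))%N ->
    nth col00 (Acols p ++ [:: col10; col10] ++ Acols q) j = cut_col n j.
  move=> p_gt0 -> lt_j; apply: nth_Acols_cat => //=; try lia.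
  by move=> [|[|//]] _; apply: (@cut_colE _ _ true false); lia.
have cut p q n : (0 < p)%N -> n = (4 * p - 1)%N ->
    (j < 2 * p - 1 + (2 * q - 1))%N ->
    nth col00 (Acols p ++ Acols q) j = cut_col n j.
  by move=> p_gt0 -> lt_j; apply: (nth_Acols_cat (mid := [::])) => //=; lia.
rewrite /Mbar_cols => g3 mg jg; have m2 := odd_double_half m.
have := ltn_pmod g (isT : 0 < 4)%N; have := divn_eq g 4.
case: (g %% 4)%N => [|[|[|[|//]]]] /= g4 _.
- move: (g %/ 4)%N g4 => k g4; rewrite /Mbar_4k; case: eqP => mE.
    rewrite (@cat_nil _ ([:: col10] ++ Acols 0)) ?size_cat ?szA -?catA /=;
      last by lia.
    by apply: cut10; lia.
  by case: ifP => m_odd; rewrite m_odd in m2; [apply: cut | apply: cut10]; lia.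
- move: (g %/ 4)%N g4 => k g4; rewrite /Mbar_4kp1; case: eqP => mE.
    rewrite (@cat_nil _ ([:: col00] ++ Acols 0)) ?szA; last by lia.
    by apply: cut00; lia.
  case: eqP => mE'.
    rewrite (@cat_nil _ ([:: col10] ++ Acols 0)) ?size_cat ?szA -?catA /=;
      last by lia.
    by apply: cut01; lia.
  by case: ifP => m_odd; rewrite m_odd in m2; [apply: cut00 | apply: cut01]; lia.
- move: (g %/ 4)%N g4 => k g4; rewrite /Mbar_4kp2; case: eqP => mE.
    rewrite (@cat_nil _ ([:: col10] ++ Acols 0)) ?size_cat ?szA -?catA /=;
      last by lia.
    by apply: cut10; lia.
  by case: ifP => m_odd; rewrite m_odd in m2; [apply: cut10 | apply: cut]; lia.
have -> : (g.+1 %/ 4 = (g %/ 4).+1)%N by lia.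
move: (g %/ 4)%N g4 => k g4; rewrite /Mbar_4km1; case: eqP => mE.
  rewrite (@cat_nil _ ([:: col00] ++ Acols 0)) ?szA; last by lia.
  by apply: cut00; lia.
case: eqP => mE'.
  rewrite (@cat_nil _ ([:: col10] ++ Acols 0)) ?size_cat ?szA -?catA /=;
    last by lia.
  by apply: cut01; lia.
by case: ifP => m_odd; rewrite m_odd in m2; [apply: cut01 | apply: cut00]; lia.
Qed.

(** * Homology classes attached to the branch points *)

Section BranchPoints.
Variables (g : nat) (H : finLmodType 'F_2) (dot : {symmetric H}).
Variables (alpha beta : 'I_g -> H).
Hypothesis hbasis : symplectic_basis dot alpha beta.

Let dotC x y : dot x y = dot y x.
Proof. by rewrite hermC expr0 mul1r. Qed.

Definition alpha_sum (k : nat) : H := \sum_(i < g | (i < k)%N) alpha i.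

(* [beta_at j] is beta_j of the text, and 0 for j = 0 and j > g: with this
   convention gamma_(2j+1) = beta_at j + beta_at j.+1 holds for 0 <= j <= g. *)
Definition beta_at (j : nat) : H := \sum_(i < g | i.+1 == j) beta i.

(* The class e_q of the header, with branch points numbered from 0. *)
Definition branch (q : nat) : H := alpha_sum q./2 + beta_at (uphalf q).

Lemma beta_at0 : beta_at 0 = 0.
Proof. by rewrite /beta_at big_pred0. Qed.

Lemma beta_at_ord (i : 'I_g) : beta_at i.+1 = beta i.
Proof. by rewrite /beta_at (big_pred1 i). Qed.

Lemma beta_at_gt j : (g < j)%N -> beta_at j = 0.
Proof.
by move=> lt_gj; rewrite /beta_at big_pred0 // => i; have := ltn_ord i; lia.
Qed.

Lemma dot_alpha_beta_at k j : (k <= g)%N ->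
  dot (alpha_sum k) (beta_at j) = ((0 < j) && (j <= k))%N%:R.
Proof.
case: j => [|j] le_k; first by rewrite beta_at0 linear0r.
have [lt_j | le_j] := ltnP j g; last first.
  by rewrite beta_at_gt // linear0r (_ : (_ <= k)%N = false) //; lia.
rewrite (beta_at_ord (Ordinal lt_j)) linear_sumlz /=.
under eq_bigr => i _ do rewrite (sympl_ab hbasis).
have [lt_jk | le_kj] /= := ltnP j k.
  rewrite (bigD1 (Ordinal lt_j)) //= eqxx big1 ?addr0 //.
  by move=> i /andP[_ /negPf->].
by rewrite big1 // => i; rewrite -val_eqE /=; case: eqP => // ->; lia.
Qed.

(* The last two terms cancel in [dot (branch a + branch b) (branch c + branch d)],
   which is the parity of the intersection of {a, b} and {c, d}. *)
Lemma dot_branch p q : (p <= (2 * g).+1)%N -> (q <= (2 * g).+1)%N ->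
  dot (branch p) (branch q) = (p == q)%:R + (p != 0)%N%:R + (q == 0)%N%:R.
Proof.
move=> le_p le_q; rewrite !linearDl !linearDr /=.
have -> k l : dot (alpha_sum k) (alpha_sum l) = 0.
  by rewrite linear_sumlz big1 // => i _; rewrite linear_sumr big1 //= => j _;
    rewrite (sympl_aa hbasis).
have -> k l : dot (beta_at k) (beta_at l) = 0.
  by rewrite linear_sumlz big1 // => i _; rewrite linear_sumr big1 //= => j _;
    rewrite (sympl_bb hbasis).
rewrite [dot (beta_at _) _]dotC !dot_alpha_beta_at; try lia.
rewrite add0r addr0 -!natr_addb; congr (nat_of_bool _)%:R; lia.
Qed.

(** The two classes share their alpha part; at an odd position they share their beta part
    instead. *)
Lemma branch_even j :
  branch j.*2 + branch j.*2.+1 = beta_at j + beta_at j.+1.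
Proof.
rewrite /branch /= uphalf_double doubleK.
by rewrite addrACA addrr_F2 add0r.
Qed.

Lemma branch_odd (j : 'I_g) : branch j.*2.+1 + branch j.*2.+2 = alpha j.
Proof.
have -> : branch j.*2.+1 = alpha_sum j + beta_at j.+1.
  by congr (alpha_sum _ + beta_at _); lia.
have -> : branch j.*2.+2 = alpha_sum j.+1 + beta_at j.+1.
  by congr (alpha_sum _ + beta_at _); lia.
rewrite addrACA addrr_F2 addr0 /alpha_sum [X in _ + X](bigD1 j) //= addrCA.
rewrite -[RHS]addr0; congr (_ + _).
rewrite -[RHS](addrr_F2 (\sum_(i < g | (i < j)%N) alpha i)); congr (_ + _).
by apply: eq_bigl => i; rewrite -val_eqE /=; lia.
Qed.

(** The correction comes from the normalization e_0 = 0, which singles out the point 0. It does not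
    depend on [a], hence cancels in sums of two classes. *)
Lemma transvection_branch (i j a : 'I_(2 * g).+2) : i != j ->
  transvection dot (branch i + branch j) (branch a) =
  branch (tperm i j a)
    + ((i == 0%N :> nat)%:R + (j == 0%N :> nat)%:R) *: (branch i + branch j).
Proof.
move=> ne_ij; rewrite /transvection linearDr /= !dot_branch -1?ltnS //.
rewrite addrACA [X in (X + _) *: _]addrACA F2_addrr addr0 scalerDl addrA.
congr (_ + _); rewrite !val_eqE.
case: tpermP => [->|->|/eqP/negPf-> /eqP/negPf->].
- by rewrite eqxx (negPf ne_ij) addr0 scale1r addrA addrr_F2 add0r.
- rewrite eqxx eq_sym (negPf ne_ij) add0r scale1r.
  by rewrite addrCA addrr_F2 addr0.
by rewrite addr0 scale0r addr0.
Qed.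

(** * Spin structures evaluated on sums of two branch classes *)

(** The sum [d] of two quadratic functions with the same polar form is linear, and the sums of two
    branch classes yield every basis vector. *)
Lemma eq_spin (c1 c2 : {ffun H -> 'F_2}) :
  c1 \in spin_structures dot -> c2 \in spin_structures dot ->
  (forall a b : 'I_(2 * g).+2,
     c1 (branch a + branch b) = c2 (branch a + branch b)) ->
  c1 = c2.
Proof.
rewrite !inE => c1P c2P eq_c.
pose d x := c1 x + c2 x.
have dD x y : d (x + y) = d x + d y.
  rewrite /d (eqP (forallP (forallP c1P x) y)) (eqP (forallP (forallP c2P x) y)).
  by rewrite addrACA F2_addrr addr0 addrACA.
have d0 : d 0 = 0 by rewrite -[RHS](F2_addrr (d 0)) -dD addr0.
have dZ k x : d x = 0 -> d (k *: x) = 0.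
  by case: (F2P k) => ->; rewrite ?scale0r ?scale1r.
have d_sum u (v : 'I_g -> H) :
    (forall i, d (v i) = 0) -> d (\sum_i u i *: v i) = 0.
  move=> dv; elim/big_ind: _ => // [x y dx dy | i _]; last exact: dZ.
  by rewrite dD dx dy addr0.
have d_branch p q : (p < (2 * g).+2)%N -> (q < (2 * g).+2)%N ->
    d (branch p + branch q) = 0.
  move=> lt_p lt_q; have := eq_c (Ordinal lt_p) (Ordinal lt_q).
  by rewrite /d /= => ->; rewrite F2_addrr.
have d_alpha i : d (alpha i) = 0.
  by rewrite -branch_odd d_branch //; have := ltn_ord i; lia.
have d_beta_at j : (j <= g)%N -> d (beta_at j) = 0.
  elim: j => [|j IHj] lt_j; first by rewrite beta_at0.
  rewrite -[LHS]add0r -{1}(IHj (ltnW lt_j)) -dD -branch_even d_branch //; lia.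
have d_beta i : d (beta i) = 0 by rewrite -beta_at_ord d_beta_at.
apply/ffunP => x; have [u [-> _]] := sympl_basis hbasis x.
set y := (X in c1 X); have : d y = 0 by rewrite /y dD !d_sum ?addr0.
by move/(congr1 (+%R^~ (c2 y))); rewrite /d add0r -addrA F2_addrr addr0.
Qed.

Lemma spin_branch (n : nat) (c : {ffun H -> 'F_2}) :
  (0 < n)%N -> c \in spin_structures dot ->
  (forall q, (q <= 2 * g)%N -> c (branch q + branch q.+1) = (q.+1 != n)%:R) ->
  forall a b : 'I_(2 * g).+2,
  c (branch a + branch b) = ((a < n)%N (+) (b < n)%N (+) (a != b))%:R.
Proof.
move=> n_gt0; rewrite inE => cP c_step.
have cD x y : c (x + y) = c x + c y + dot x y.
  by apply/eqP; apply: (forallP (forallP cP x)).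
(* As e_0 = 0, the value is 1 exactly when [q] is a nonzero point on the same side of the cut as
   0. *)
have c_branch q : (q <= (2 * g).+1)%N ->
    c (branch q) = ((q != 0)%N (+) ~~ (q < n)%N)%:R.
  elim: q => [|q IHq] le_q.
    rewrite n_gt0 /= /branch beta_at0 addr0 /alpha_sum big_pred0 //.
    by rewrite -[in LHS](addr0 0) cD linear0r addr0 F2_addrr.
  have -> : branch q.+1 = branch q + (branch q + branch q.+1).
    by rewrite addrA addrr_F2 add0r.
  rewrite cD linearDr /= !dot_branch ?IHq ?c_step; try lia.
  rewrite eqxx (ltn_eqF (ltnSn q)) [(q < n)%N]leq_eqVlt -!natr_addb.
  by congr (nat_of_bool _)%:R; case: (q == 0)%N; case: (ltngtP q.+1 n).
have le_ord (x : 'I_(2 * g).+2) : (x <= (2 * g).+1)%N by rewrite -ltnS.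
move=> a b; rewrite cD dot_branch ?c_branch //.
rewrite -!natr_addb -val_eqE; congr (nat_of_bool _)%:R.
case: (a == 0 :> nat)%N; case: (b == 0 :> nat)%N; case: (a == b :> nat);
  by case: (a < n)%N; case: (b < n)%N.
Qed.

(** * The symmetric group acting on the branch classes *)

Variable iota : {morphism [set: 'S_(2 * g).+2] >-> {perm H}}.
Hypotheses (g_gt0 : (0 < g)%N) (hiota : is_iota dot alpha beta iota).

Lemma iotaD s : {morph iota s : x y / x + y}.
Proof.
have := iota_Sp hiota s; rewrite inE => /andP[/forallP/(_ 1)/forallP lin _] x y.
by have /forallP/(_ y)/eqP := lin x; rewrite !scale1r.
Qed.

Lemma iota_dot s x y : dot (iota s x) (iota s y) = dot x y.
Proof.
have := iota_Sp hiota s; rewrite inE => /andP[_ /forallP/(_ x)/forallP/(_ y)].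
by move/eqP.
Qed.

(** Merges the four clauses of [is_iota]: the two extreme generators fit the odd pattern because
    [beta_at] vanishes at 0 and g+1. *)
Lemma iota_sigma i : (i <= 2 * g)%N ->
  iota (sigma g i.+1) =1 transvection dot (branch i + branch i.+1).
Proof.
move=> + x; rewrite -[i]odd_double_half.
case: (odd i); move: i./2 => k {i} le_k; rewrite ?add1n ?add0n.
  have lt_k : (k < g)%N by lia.
  have := iota_even hiota (Ordinal lt_k) x.
  by rewrite -branch_odd /= (mul2n k.+1).
have [-> | k_gt0] := posnP k.
  rewrite branch_even beta_at0 add0r.
  have := iota_first hiota (i := Ordinal g_gt0) erefl x.
  by rewrite -beta_at_ord.
have [lt_k | ge_k] := ltnP k g.
  have lt_k' : (k.-1 < g)%N by lia.
  have := iota_odd hiota (i := Ordinal lt_k') (j := Ordinal lt_k).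
  rewrite -!beta_at_ord /= prednK // -branch_even => /(_ erefl x).
  by rewrite (mul2n k).
have -> : k = g by lia.
have lt_g : (g.-1 < g)%N by lia.
have := iota_last hiota (i := Ordinal lt_g) (prednK g_gt0) x.
rewrite -beta_at_ord /= prednK // -[beta_at g]addr0.
by rewrite -(beta_at_gt (ltnSn g)) -branch_even -mul2n.
Qed.

(** The permutations satisfying this for all pairs form a group, so it suffices to treat the
    [sigma g i], where the two corrections of [transvection_branch] cancel. *)
Lemma iota_branch s (a b : 'I_(2 * g).+2) :
  iota s (branch a + branch b) = branch (s a) + branch (s b).
Proof.
pose G := [set s | [forall a : 'I_(2 * g).+2, forall b : 'I_(2 * g).+2,
  iota s (branch a + branch b) == branch (s a) + branch (s b)]].
have GP t : reflect (forall a b : 'I_(2 * g).+2,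
    iota t (branch a + branch b) = branch (t a) + branch (t b)) (t \in G).
  rewrite inE; apply: (iffP forallP) => [tP c d | tP c].
    exact/eqP/(forallP (tP c)).
  by apply/forallP => d; rewrite tP.
have gG : group_set G.
  apply/group_setP; split=> [|t u /GP tP /GP uP]; apply/GP => c d.
    by rewrite morph1 !perm1.
  by rewrite morphM ?inE // !permM tP uP.
suff /GP : s \in Group gG by [].
apply: sigmas_generate => i /andP[i_gt0 le_i]; apply/GP => c d.
rewrite iotaD -(prednK i_gt0) !iota_sigma; try lia.
have lt_i : (i.-1 < (2 * g).+2)%N by lia.
have lt_i1 : (i.-1.+1 < (2 * g).+2)%N by lia.
have sigE : sigma g i.-1.+1 = tperm (Ordinal lt_i) (Ordinal lt_i1).
  by congr tperm; apply: val_inj; rewrite /= inordK.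
have ne_i : Ordinal lt_i != Ordinal lt_i1 by rewrite -val_eqE /=; lia.
rewrite !(transvection_branch _ ne_i).
by rewrite addrACA addrr_F2 addr0 -!sigE.
Qed.

(** The transformed function is again a spin structure, so [eq_spin] applies to it and [c]. *)
Lemma isotropyP (c : {ffun H -> 'F_2}) (s : 'S_(2 * g).+2) :
  c \in spin_structures dot ->
  reflect (forall a b : 'I_(2 * g).+2,
             c (branch (s a) + branch (s b)) = c (branch a + branch b))
          (s \in isotropy iota c).
Proof.
move=> cP; rewrite inE; apply: (iffP eqP) => [sc a b | sc].
  by rewrite -{2}sc ffunE iota_branch.
apply: eq_spin => // [|a b]; last by rewrite ffunE iota_branch.
rewrite inE; apply/forallP => x; apply/forallP => y; rewrite !ffunE iotaD.
by move: cP; rewrite inE => /forallP/(_ (iota s x))/forallP/(_ (iota s y))/eqP->;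
  rewrite iota_dot.
Qed.

End BranchPoints.

(** * Isotropy groups as stabilizers of the cut *)

Lemma card_ltn_ord (N n : nat) : (n <= N)%N -> #|[set x : 'I_N | (x < n)%N]| = n.
Proof.
move=> le_nN; rewrite cardsE -sum1_card.
by rewrite -(big_ord_widen _ (fun=> 1%N) le_nN) sum1_card card_ord.
Qed.

(** For distinct points [c] detects whether they lie on the same side. Preserving this relation
    means keeping both sides ([b] false) or exchanging them ([b] true). *)
Lemma isotropy_MbarP (g : nat) (H : finLmodType 'F_2) (dot : {symmetric H})
    (alpha beta : 'I_g -> H)
    (iota : {morphism [set: 'S_(2 * g).+2] >-> {perm H}})
    (m : nat) (c : {ffun H -> 'F_2}) :
  (3 <= g)%N -> symplectic_basis dot alpha beta ->
  is_iota dot alpha beta iota -> (m <= uphalf g)%N ->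
  c \in spin_structures dot -> spin_matrix alpha beta c = Mbar g m ->
  let f (x : 'I_(2 * g).+2) := (x < g + 1 + 2 * m)%N in
  forall s : 'S_(2 * g).+2,
    reflect (exists b, forall x, f (s x) = f x (+) b) (s \in isotropy iota c).
Proof.
move=> g3 hbasis hiota le_m cP cM f s.
have g_gt0 : (0 < g)%N by lia.
have colE (j : 'I_g) : (c (alpha j), c (beta j)) = nth col00 (Mbar_cols g m) j.
  have /matrixP Mj := cM; have := Mj 0 j; have := Mj 1 j.
  by rewrite !mxE /= => -> ->; case: nth.
have c0 : c 0 = 0.
  move: (cP); rewrite inE => /forallP/(_ 0)/forallP/(_ 0)/eqP.
  by rewrite addr0 linear0r addr0 F2_addrr.
have cB j : (j <= g.+1)%N -> c (beta_at beta j) =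
    (odd j (+) (odd (g + 1 + 2 * m) && (g + 1 + 2 * m < j.*2)%N))%:R.
  case: j => [|j] le_j; first by rewrite beta_at0 c0 ltn0 andbF.
  have [lt_j | ge_j] := ltnP j g.
    have := colE (Ordinal lt_j); rewrite nth_Mbar_cols // /cut_col.
    by rewrite (beta_at_ord _ (Ordinal lt_j)) => -[_ ->].
  (* Here j = g+1: n = g+1+2m has the parity of g+1 and is at most 2g+2, so an odd [n] is below 2g+2
     and the two parities cancel. *)
  rewrite beta_at_gt // c0 (_ : (_ (+) _) = false) //; lia.
have cE (a b : 'I_(2 * g).+2) : c (branch alpha beta a + branch alpha beta b) =
    (f a (+) f b (+) (a != b))%:R.
  apply: (spin_branch hbasis) => // [|q le_q]; first by lia.
  move: le_q; rewrite -[q]odd_double_half.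
  case: (odd q); move: q./2 => k {q} le_k; rewrite ?add1n ?add0n.
    have lt_k : (k < g)%N by lia.
    have := colE (Ordinal lt_k); rewrite nth_Mbar_cols // /cut_col.
    by rewrite (branch_odd alpha beta (Ordinal lt_k)) => -[->].
  (* The beta classes are mutually orthogonal, so [c] adds over them and two consecutive bottom
     entries give c(gamma_(2k+1)). *)
  rewrite branch_even; move: (cP); rewrite inE => /forallP/(_ (beta_at beta k)).
  move=> /forallP/(_ (beta_at beta k.+1))/eqP ->.
  rewrite !cB; try lia.
  have -> : dot (beta_at beta k) (beta_at beta k.+1) = 0.
    rewrite linear_sumlz big1 // => i _; rewrite linear_sumr big1 //= => j _.
    by rewrite (sympl_bb hbasis).
  rewrite addr0 -natr_addb; congr (nat_of_bool _)%:R; lia.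
apply: (iffP (isotropyP hbasis g_gt0 hiota s cP)) => [sE | [b sb] x y].
  (* Whether the point 0 changes side decides it for every [x], by comparing [x] with 0. *)
  exists (f ord0 (+) f (s ord0)) => x.
  have := sE x ord0; rewrite !cE (inj_eq perm_inj) => /natr_bool_inj.
  by case: (f x); case: (f ord0); case: (f (s x)); case: (f (s ord0)); case: eqP.
rewrite !cE (inj_eq perm_inj) !sb.
by congr (nat_of_bool _)%:R; case: b {sb}; case: (f x); case: (f y).
Qed.

Theorem corollary4p6 (g : nat) (hg : (3 <= g)%N)
    (H : finLmodType 'F_2) (dot : {symmetric H}) (alpha beta : 'I_g -> H)
    (hbasis : symplectic_basis dot alpha beta)
    (iota : {morphism [set: 'S_(2 * g).+2] >-> {perm H}})
    (hiota : is_iota dot alpha beta iota) :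
  (forall (m : nat) (c : {ffun H -> 'F_2}),
      (1 <= m <= uphalf g)%N ->
      c \in spin_structures dot ->
      spin_matrix alpha beta c = Mbar g m ->
      isotropy iota c = Gpos g m /\
      Gpos g m \isog
        setX [set: 'S_(g + 1 + 2 * m)] [set: 'S_(g + 1 - 2 * m)]) /\
  (forall c : {ffun H -> 'F_2},
      c \in spin_structures dot ->
      spin_matrix alpha beta c = Mbar g 0 ->
      isotropy iota c = Gzero g).
Proof.
split=> [m c /andP[m_gt0 le_m] cP cM | c cP cM].
  rewrite /Gpos gen_sigmas_but; split; last by apply: astabs_isog; lia.
  have isoP := isotropy_MbarP hg hbasis hiota le_m cP cM.
  apply/setP => s; apply/isoP/astabs_permP => [[b sb] x | sf].
    case: b sb => sb; last by rewrite sb addbF.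
    pose S := [set x : 'I_(2 * g).+2 | (x < g + 1 + 2 * m)%N].
    (* An exchange would inject a block of g+1+2m points into its complement of g+1-2m points,
       impossible for m > 0. *)
    have : (#|s @: S| <= #|~: S|)%N.
      apply/subset_leq_card/subsetP => _ /imsetP[y Sy ->].
      by move: Sy; rewrite !inE sb addbT negbK.
    rewrite card_imset; last exact: perm_inj.
    have := cardsC S; rewrite card_ord card_ltn_ord; lia.
  by exists false => x; rewrite addbF sf.
have isoP0 := isotropy_MbarP hg hbasis hiota (leq0n _) cP cM.
apply/eqP; rewrite eqEsubset; apply/andP; split.
  apply/subsetP => s /isoP0[b sb].
  have sG : <<sigmas_but g (g + 1)>>%g \subset Gzero g by apply/genS/subsetUr.
  have tG : tau g \in Gzero g by apply/mem_gen/setU11.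
  case: b sb => sb; last first.
    apply: (subsetP sG); rewrite gen_sigmas_but; apply/astabs_permP => x.
    by have := sb x; rewrite addn0 addbF.
  (* Both [s] and [tau g] exchange the two halves, so their product preserves each. *)
  rewrite /Gzero -(groupMr _ tG); apply: (subsetP sG).
  rewrite gen_sigmas_but; apply/astabs_permP => x; rewrite permM tau_rev /=.
  by have := sb x; have := ltn_ord x; have := ltn_ord (s x); lia.
have gI : group_set (isotropy iota c).
  apply/group_setP; split => [|s t /isoP0[b sb] /isoP0[d td]]; apply/isoP0.
    by exists false => x; rewrite perm1 addbF.
  by exists (b (+) d) => x; rewrite permM td sb addbA.
rewrite -[isotropy iota c]/(gval (Group gI)) gen_subG subUset sub1set.
apply/andP; split.
  by apply/isoP0; exists true => x; rewrite tau_rev /=; have := ltn_ord x; lia.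
rewrite -gen_subG gen_sigmas_but; apply/subsetP => s /astabs_permP sP.
by apply/isoP0; exists false => x; rewrite addbF addn0 sP.
Qed.
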